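(* Let $R=\mathbb{Z}_n$ with $n$ odd. Then $\{G_R,G_R^+,\bar G_R\}$ are equienergetic non-isospectral Ramanujan graphs if and only if (up to isomorphism of rings) (a) $R=\mathbb{Z}_{p^2}$ with $p$ an odd prime, in the local case; or (b) $R\in\{\mathbb{Z}_3\times\mathbb{Z}_5,\ \mathbb{Z}_3\times\mathbb{Z}_7,\ \mathbb{Z}_5\times\mathbb{Z}_5,\ \mathbb{Z}_5\times\mathbb{Z}_7,\ \mathbb{Z}_7\times\mathbb{Z}_7,\ \mathbb{Z}_{11}\times\mathbb{Z}_{11}\}$, in the non-local case.
   Context: $\mathbb{Z}_n$ is the ring of integers modulo $n$; rings have $1\neq0$ (so $n>1$). $G_R$ is the graph with vertex set $R$ in which $v,w$ are adjacent iff $w-v\in R^*$ (the group of units of $R$); $G_R^+$ is the graph with vertex set $R$ in which $v,w$ are adjacent iff $v+w\in R^*$ (with a loop at $x$ when $x+x\in R^*$); $\bar G_R$ is the (loopless) complement of $G_R$. All are regular (a loop contributes $1$ to the degree). Eigenvalues are those of the adjacency matrix (a loop gives a diagonal entry $1$). The energy is the sum of the absolute values of the eigenvalues with multiplicity. A set of graphs with the same number of vertices is equienergetic if all have the same energy, and non-isospectral if they have pairwise different spectra (eigenvalues with multiplicities). A $k$-regular graph is Ramanujan if every eigenvalue $\lambda$ with $|\lambda|\neq k$ satisfies $|\lambda|\le 2\sqrt{k-1}$ (connectedness is not required). *)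

(* Defs.v *)
From HB Require Import structures.
From mathcomp Require Import all_boot all_order all_algebra all_field.

Set Implicit Arguments.
Unset Strict Implicit.
Unset Printing Implicit Defensive.

Import Order.TTheory GRing.Theory Num.Theory.
Local Open Scope ring_scope.

(* A graph on a finite vertex set V is given by its adjacency relation
   e : rel V, with e x x meaning that there is a loop at x. *)
Section Graphs.
Variable V : finType.
Implicit Types (e : rel V) (k : nat).

Definition graph_compl e : rel V := [rel v w | (v != w) && ~~ e v w].

(* A loop at v puts v in its own neighbourhood, so it contributes 1. *)
Definition regular k e : Prop := forall v, #|[set w | e v w]| = k.

Definition adjacency_mx e : 'M[algC]_#|V| :=
  \matrix_(i, j) (e (enum_val i) (enum_val j))%:R.

(* The roots of the characteristic polynomial, with multiplicities; being the
   eigenvalues of a 0-1 matrix, they all live in algC. The order of this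
   sequence is irrelevant: use it only up to perm_eq. *)
Definition spectrum e : seq algC :=
  sval (closed_field_poly_normal (char_poly (adjacency_mx e))).

Definition energy e : algC := \sum_(z <- spectrum e) `|z|.

(* k%:R - 1 is computed in algC, hence is -1 (not 0) when k = 0; in that case
   all eigenvalues are 0 and the condition is vacuous. *)
Definition ramanujan e : Prop :=
  exists2 k, regular k e &
    forall z, z \in spectrum e -> `|z| != k%:R -> `|z| <= 2 * sqrtC (k%:R - 1).

Definition equienergetic (es : seq (rel V)) : bool :=
  pairwise (fun e f => energy e == energy f) es.

Definition non_isospectral (es : seq (rel V)) : bool :=
  pairwise (fun e f => ~~ perm_eq (spectrum e) (spectrum f)) es.

End Graphs.

Section RingGraphs.
Variable R : finComUnitRingType.

Definition unitary_cayley : rel R := [rel v w | w - v \is a GRing.unit].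

Definition unitary_cayley_sum : rel R := [rel v w | v + w \is a GRing.unit].

(* idealr_closed already includes properness (1 \notin I). *)
Definition maximal_ideal (I : {set R}) : Prop :=
  idealr_closed I /\
  forall J : {set R}, idealr_closed J -> I \subset J -> J = I.

Definition local_ring : Prop := exists! I : {set R}, maximal_ideal I.

End RingGraphs.

Definition ring_isomorphic (R S : nzRingType) : Prop :=
  exists f : {rmorphism R -> S}, bijective f.

(* Main.v *)
From HB Require Import structures.
Require Import Defs.
From mathcomp Require Import all_boot all_order all_algebra all_field.
From mathcomp Require Import zify ring.

Set Implicit Arguments.
Unset Strict Implicit.
Unset Printing Implicit Defensive.

Import Order.TTheory GRing.Theory Num.Theory.
Local Open Scope ring_scope.

(** Write G, G+ and G' for the unitary Cayley graph of Z_n, its sum version and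
    its complement, and phi for the totient of n, which is the degree of G.
    Both G and G' are Cayley graphs of the additive group, so the characters
    of Z_n diagonalize them ([spectrum_cayley]): the eigenvalues of G are the
    Ramanujan sums c(k), the sums of the k-th character over the units, and
    those of G' are n[k = 0] - 1 - c(k).

    G+ needs no diagonalization.  Since x and -x are units together, its
    adjacency matrix has the same square as that of G, so the two spectra agree
    up to absolute values ([perm_norm_spectrum]); energy and the Ramanujan
    property do not see the difference.  The trace does: for n odd, 2 is a unit,
    so G+ has phi loops while G and G' have none, which makes G+ isospectral to
    neither.  G and G' are told apart by their degrees, because the degree of a
    Cayley graph is its largest eigenvalue.

    Suppose that the three graphs have the required properties, and let p be
    the least prime divisor of n.  The sum c(n/p) is -phi/(p-1)
    ([ramanujan_sum_cofactor]), so the Ramanujan bound for G reads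
    phi^2 <= 4 (p-1)^2 (phi-1), and in particular phi < 4 (p-1)^2.  As phi is
    roughly the product of the prime factors, this leaves room for at most two
    of them: n is p, p^2, or pq with p < q ([few_primes_of_totient_le]).  For
    n = p the complement has no edge and energy 0, so n = p is excluded.  For
    n = pq the complement has the eigenvalue q - 2 and degree p + q - 2, and its
    Ramanujan bound forces q <= 7, that is, n is 15, 21 or 35.

    Conversely, in these cases the Ramanujan sums are integers given by
    inclusion-exclusion, and the bounds are checked on them.  For energies,
    |-1 - c| - |c| is 1 for an integer c >= 0 and -1 for c < 0; hence G and G'
    have the same energy exactly when the number of negative c(k) is the degree
    of G' ([equienergetic_complE]), which a count confirms for p^2 and pq.

    On the ring side, the multiples of a prime divisor of n form a maximal
    ideal, so Z_n is local for n = p^2 and not for n = pq; an isomorphism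
    determines n as the cardinality of the target, and 25, 49 and 121 are
    squares of primes, so that every ring of the list yields one of the n
    found above. *)

(** * Characteristic polynomials of similar matrices and of squares *)

Lemma char_poly_similar (F : fieldType) m (P A B : 'M[F]_m) :
  P \in unitmx -> P *m A = B *m P -> char_poly A = char_poly B.
Proof.
move=> uP PA; pose Q := map_mx (@polyC F) P.
have nzQ : \det Q != 0 by rewrite det_map_mx polyC_eq0 -unitfE -unitmxE.
apply: (mulfI nzQ); rewrite /char_poly -det_mulmx [RHS]mulrC -det_mulmx.
by rewrite /char_poly_mx mulmxBr mulmxBl -!map_mxM PA scalar_mxC.
Qed.

Lemma char_poly_similar_diag (F : fieldType) m (P A : 'M[F]_m) (d : 'rV_m) :
  P \in unitmx -> P *m A = diag_mx d *m P ->
  char_poly A = \prod_i ('X - (d 0 i)%:P).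
Proof.
move=> uP /(char_poly_similar uP) ->; rewrite char_poly_trig.
  by apply: eq_bigr => i _; rewrite mxE eqxx.
exact/diag_mx_is_trig.
Qed.

(** Over the algebraic numbers a matrix is similar to a triangular one, where
    squaring squares the diagonal. *)
Lemma char_poly_exp2 m (A : 'M[algC]_m) (s : seq algC) :
  char_poly A = \prod_(z <- s) ('X - z%:P) ->
  char_poly (A *m A) = \prod_(z <- s) ('X - (z ^+ 2)%:P).
Proof.
have [|P /unitarymx_unit uP] := @cotrigonalization algC m [:: A].
  by move=> ? ? /[!inE] /eqP-> /eqP->.
rewrite /= andbT /similar_to => trigT.
have PA : P *m A = conjmx P A *m P by rewrite conjumx // -!mulmxA mulVmx ?mulmx1.
move: (conjmx P A) trigT PA => T /is_trig_mxP T0 PA.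
have PA2 : P *m (A *m A) = (T *m T) *m P by rewrite [LHS]mulmxA PA -[LHS]mulmxA PA mulmxA.
rewrite (char_poly_similar uP PA) (char_poly_similar uP PA2).
rewrite !char_poly_trig; first last.
- exact/is_trig_mxP.
- apply/is_trig_mxP => i j ij; rewrite mxE big1 // => k _.
  have [ik|ki] := ltnP i k; first by rewrite T0 ?mul0r.
  by rewrite [T k j]T0 ?mulr0 // (leq_ltn_trans ki).
rewrite -(big_map (fun i => T i i) xpredT (fun z => 'X - z%:P)).
move=> /prod_XsubC_eq eq_s; rewrite -(perm_big _ eq_s) /= big_map.
apply: eq_bigr => i _; rewrite mxE (bigD1 i) //= big1 ?addr0 // => k ki.
move: ki; rewrite neq_ltn => /orP[ki|ik]; last by rewrite T0 ?mul0r.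
by rewrite [T k i]T0 ?mulr0.
Qed.

(** * Spectra of graphs *)

Lemma sum_enum_val (V : finType) (F : V -> algC) :
  \sum_(i < #|V|) F (enum_val i) = \sum_x F x.
Proof. by rewrite [RHS](reindex _ (onW_bij _ (@enum_val_bij V))). Qed.

Section Spectra.
Variable V : finType.
Implicit Types (e f : rel V) (s : seq algC) (k : nat).

Lemma char_poly_adjacency e :
  char_poly (adjacency_mx e) = \prod_(z <- spectrum e) ('X - z%:P).
Proof.
rewrite /spectrum; case: closed_field_poly_normal => s /= {1}->.
by rewrite (monicP (char_poly_monic _)) scale1r.
Qed.

Lemma eq_spectrum e f : e =2 f -> spectrum e = spectrum f.
Proof.
move=> ef; rewrite /spectrum.
suff -> : adjacency_mx e = adjacency_mx f by [].
by apply/matrixP => i j; rewrite !mxE ef.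
Qed.

Lemma spectrum_unique e s :
  char_poly (adjacency_mx e) = \prod_(z <- s) ('X - z%:P) ->
  perm_eq (spectrum e) s.
Proof. by rewrite char_poly_adjacency => /prod_XsubC_eq. Qed.

Lemma size_spectrum e : size (spectrum e) = #|V|.
Proof.
have := size_char_poly (adjacency_mx e).
by rewrite char_poly_adjacency size_prod_XsubC => -[].
Qed.

(** The trace of the adjacency matrix. *)
Lemma sum_spectrum e : \sum_(z <- spectrum e) z = #|[pred v | e v v]|%:R.
Proof.
have [V0|V_gt0] := posnP #|V|.
  have /size0nil -> := etrans (size_spectrum e) V0.
  by rewrite big_nil eq_card0 // => v; have := card0_eq V0 v.
have := char_poly_trace (adjacency_mx e) V_gt0.
rewrite char_poly_adjacency -{1}(size_spectrum e) coefPn_prod_XsubC; last first.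
  by rewrite size_spectrum -lt0n.
have -> : #|[pred v | e v v]|%:R = \sum_v (e v v)%:R :> algC.
  rewrite -sum1_card natr_sum big_mkcond; apply: eq_bigr => v _.
  by rewrite inE; case: ifP.
move/oppr_inj->; rewrite -sum_enum_val.
by apply: eq_bigr => i _; rewrite mxE.
Qed.

(** The square of the adjacency matrix determines the squares of the eigenvalues,
    hence their absolute values. *)
Lemma perm_norm_spectrum e f :
  adjacency_mx e *m adjacency_mx e = adjacency_mx f *m adjacency_mx f ->
  perm_eq [seq `|z| | z <- spectrum e] [seq `|z| | z <- spectrum f].
Proof.
move=> ef; have := char_poly_exp2 (char_poly_adjacency e).
rewrite ef (char_poly_exp2 (char_poly_adjacency f)).
rewrite -(big_map (fun z => z ^+ 2) xpredT (fun z => 'X - z%:P)).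
rewrite -[RHS](big_map (fun z => z ^+ 2) xpredT (fun z => 'X - z%:P)).
move=> /prod_XsubC_eq /(perm_map (fun z => sqrtC `|z|)).
rewrite -!map_comp perm_sym.
have abs z : (fun z : algC => sqrtC `|z|) (z ^+ 2) = `|z|.
  by rewrite /= normrX sqrCK.
by rewrite !(eq_map (abs : _ \o _ =1 _)).
Qed.

Lemma energy_norm_spectrum e f :
  perm_eq [seq `|z| | z <- spectrum e] [seq `|z| | z <- spectrum f] ->
  energy e = energy f.
Proof.
by rewrite /energy -!(big_map Num.norm xpredT id); apply: perm_big.
Qed.

(** A vertex [v] is needed because on an empty vertex set every degree is right. *)
Lemma regular_inj (v : V) e k l : regular k e -> regular l e -> k = l.
Proof. by move=> /(_ v) <- /(_ v). Qed.

Lemma ramanujanP (v : V) e k : regular k e ->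
  ramanujan e <-> forall z, z \in spectrum e -> `|z| != k%:R ->
                    `|z| <= 2 * sqrtC (k%:R - 1).
Proof.
move=> rk; split; last by exists k.
by case=> l /(regular_inj v rk) <-.
Qed.

Lemma ramanujan_norm_spectrum (v : V) e f k :
  regular k e -> regular k f ->
  perm_eq [seq `|z| | z <- spectrum e] [seq `|z| | z <- spectrum f] ->
  ramanujan e -> ramanujan f.
Proof.
move=> re rf ef /(ramanujanP v re) He; apply/(ramanujanP v rf) => z zf.
have : `|z| \in [seq `|z| | z <- spectrum e].
  by rewrite (perm_mem ef) map_f.
by case/mapP => y ye ->; apply: He.
Qed.

End Spectra.

Lemma ramanujan_boundE (m k : nat) : (0 < k)%N ->
  (m%:R <= 2 * sqrtC (k%:R - 1) :> algC) = (m ^ 2 <= 4 * k.-1)%N.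
Proof.
case: k => // k _; rewrite -[k.+1%:R]natr1 addrK.
rewrite -(@ler_sqr _ m%:R) ?nnegrE ?mulr_ge0 ?sqrtC_ge0 ?ler0n //.
by rewrite exprMn sqrtCK -!natrX -natrM ler_nat.
Qed.

(** * Divisibility and units modulo n *)

Section ResidueArithmetic.
Variables (n : nat) (n_gt1 : (1 < n)%N).
Implicit Types x y k : 'Z_n.

Lemma card_Zn : #|'Z_n| = n.
Proof. by rewrite card_ord Zp_cast. Qed.

Lemma unit_Zn x : (x \is a GRing.unit) = coprime n x.
Proof. by rewrite -{1}[x]natr_Zp unitZpE. Qed.

Lemma natr_Zn_eq0 m : (m%:R == 0 :> 'Z_n) = (n %| m)%N.
Proof. by rewrite -val_eqE /= val_Zp_nat. Qed.

Lemma natr_Zn0 : n%:R = 0 :> 'Z_n.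
Proof. by apply/eqP; rewrite natr_Zn_eq0. Qed.

Lemma val_Zn_eq0 x : (x == 0) = (n %| x)%N.
Proof. by rewrite -natr_Zn_eq0 natr_Zp. Qed.

(** Divisibility of representatives as an annihilation condition in the ring:
    closure properties of the multiples of p become identities. *)
Lemma dvd_val_Zn p m x : n = (p * m)%N -> (p %| x)%N = (m%:R * x == 0).
Proof.
move=> def_n; have m_gt0 : (0 < m)%N by lia.
rewrite -[x in RHS]natr_Zp -natrM natr_Zn_eq0 [X in (X %| m * x)%N]def_n.
by rewrite mulnC dvdn_pmul2l.
Qed.

Lemma zmod_closed_multiples p : (p %| n)%N ->
  zmod_closed [pred x : 'Z_n | p %| x]%N.
Proof.
case/dvdnP=> m; rewrite mulnC => def_n.
split=> [|x y]; rewrite !inE ?dvdn0 // !(dvd_val_Zn _ def_n).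
by move=> /eqP px /eqP py; rewrite mulrBr px py subrr.
Qed.

Lemma card_multiples p m : n = (p * m)%N ->
  #|[pred x : 'Z_n | p %| x]%N| = m.
Proof.
move=> def_n; have p_gt0 : (0 < p)%N by lia.
pose f (j : 'I_m) : 'Z_n := (p * j)%:R.
have val_f j : f j = (p * j)%N :> nat.
  by rewrite /f val_Zp_nat // modn_small // [X in (_ < X)%N]def_n ltn_pmul2l.
have f_inj : injective f.
  move=> i j eq_f; have /eqP := val_f i; rewrite eq_f val_f.
  by rewrite eqn_pmul2l // => /eqP /val_inj.
rewrite -[RHS]card_ord -(card_codom f_inj); apply: eq_card => x; rewrite inE.
apply/idP/codomP => [/dvdnP[j def_x]|[j ->]]; last first.
  by rewrite [X in (_ %| X)%N]val_f dvdn_mulr.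
have j_m : (j < m)%N.
  by have := ltn_ord x; rewrite [X in (_ < X)%N]Zp_cast // def_x; nia.
by exists (Ordinal j_m); apply: val_inj; rewrite [RHS]val_f /= def_x mulnC.
Qed.

Lemma card_units_Zn : #|[pred x : 'Z_n | x \is a GRing.unit]| = totient n.
Proof.
rewrite totient_count_coprime -sum1_card big_mkcond /=.
rewrite -[X in index_iota 0 X](Zp_cast n_gt1) big_mkord.
by apply: eq_bigr => x _; rewrite inE unit_Zn; case: coprime.
Qed.

End ResidueArithmetic.

(** * Additive characters and Cayley graphs modulo n *)

Section AdditiveCharacters.
Variables (n : nat) (n_gt1 : (1 < n)%N).
Implicit Types x y k : 'Z_n.

(** The order of the root is [#|'Z_n|], which is n only for n > 1; this makes
    the definition total. *)
Definition zeta : algC := sval (C_prim_root_exists (ltn0Sn (Zp_trunc n).+1)).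

(** The characters of the group 'Z_n are the maps [fun x => echar (k * x)]. *)
Definition echar x : algC := zeta ^+ x.

Lemma zeta_prim : n.-primitive_root zeta.
Proof.
by rewrite -[X in X.-primitive_root _]Zp_cast // /zeta; case: C_prim_root_exists.
Qed.

Lemma echar_nat m : echar m%:R = zeta ^+ m.
Proof. by rewrite /echar val_Zp_nat // (prim_expr_mod zeta_prim). Qed.

Lemma echarD x y : echar (x + y) = echar x * echar y.
Proof. by rewrite -{1}[x]natr_Zp -{1}[y]natr_Zp -natrD echar_nat exprD. Qed.

Lemma echar0 : echar 0 = 1. Proof. by []. Qed.

Lemma echarX x m : echar (x *+ m) = echar x ^+ m.
Proof. by elim: m => // m IHm; rewrite mulrS exprS echarD IHm. Qed.

Lemma echar_eq1 x : (echar x == 1) = (x == 0).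
Proof. by rewrite val_Zn_eq0 // (prim_order_dvd zeta_prim). Qed.

(** If the character is not 1 at some h of the subgroup H, translation by h
    multiplies the sum by that value, so the sum vanishes. *)
Lemma sum_echar_subgroup (H : {pred 'Z_n}) k : zmod_closed H ->
  \sum_(x in H) echar (k * x) =
    if [forall x in H, k * x == 0] then #|H|%:R else 0.
Proof.
move=> [H0 HB]; have HN x : x \in H -> - x \in H.
  by move=> Hx; rewrite -[- x]add0r HB.
case: ifPn => [/forall_inP kH | /forall_inPn[h Hh kh]].
  rewrite -sum1_card natr_sum; apply: eq_bigr => x Hx.
  by rewrite (eqP (kH x Hx)) echar0.
set S := \sum_(x in H) _; suff : (echar (k * h) - 1) * S = 0.
  by move/eqP; rewrite mulf_eq0 subr_eq0 echar_eq1 (negPf kh) => /eqP.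
rewrite mulrBl mul1r /S mulr_sumr [X in _ - X](reindex_inj (addrI h)) /=.
rewrite [X in _ - X](eq_bigl [in H]) => [|x]; last first.
  apply/idP/idP=> [hx|Hx]; last by rewrite -[x]opprK HB ?HN.
  by rewrite -[x](addKr h) addrC HB.
by apply/eqP; rewrite subr_eq0; apply/eqP/eq_bigr => x _; rewrite mulrDr echarD.
Qed.

Lemma sum_echar k : \sum_x echar (k * x) = if k == 0 then n%:R else 0.
Proof.
rewrite (@sum_echar_subgroup predT) // card_Zn //; congr (if _ then _ else _).
apply/forall_inP/eqP => [/(_ 1 isT)|-> x _]; last by rewrite mul0r.
by rewrite mulr1 => /eqP.
Qed.

Lemma sum_echar_multiples p m k : n = (p * m)%N ->
  \sum_(x : 'Z_n | (p %| x)%N) echar (k * x) = if (m %| k)%N then m%:R else 0.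
Proof.
move=> def_n; have p_n : (p %| n)%N by rewrite def_n dvdn_mulr.
rewrite (sum_echar_subgroup k (zmod_closed_multiples _ p_n)) //.
rewrite (card_multiples n_gt1 def_n); congr (if _ then _ else _).
rewrite (@dvd_val_Zn _ n_gt1 m p) 1?mulnC // mulrC.
apply/forall_inP/eqP => [|kp x /dvdnP[j def_x]].
  by move=> kH; apply/eqP/kH; rewrite inE val_Zp_nat // /dvdn modn_dvdm // modnn.
by rewrite -[x]natr_Zp def_x mulnC natrM mulrA kp mul0r.
Qed.

Definition cayley (S : pred 'Z_n) : rel 'Z_n := [rel v w | S (w - v)].

Lemma regular_cayley (S : pred 'Z_n) : regular #|S| (cayley S).
Proof.
move=> v; rewrite -[RHS](card_imset _ (addIr v)); apply: eq_card => w.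
rewrite inE /cayley /=; apply/idP/imsetP=> [Sw|[x Sx ->]]; last by rewrite addrK.
by exists (w - v); rewrite ?subrK.
Qed.

(** The characters are eigenvectors: in the sum over the neighbours of a vertex,
    the position of the vertex factors out.  Orthogonality of characters makes
    the matrix P that they form invertible. *)
Lemma spectrum_cayley (S : pred 'Z_n) :
  perm_eq (spectrum (cayley S))
    [seq \sum_(x | S x) echar (k * x) | k <- enum 'Z_n].
Proof.
pose mu k : algC := \sum_(x | S x) echar (k * x).
pose P := \matrix_(i < #|'Z_n|, j < #|'Z_n|)
  echar (- (enum_val i * enum_val j)).
have uP : P \in unitmx.
  pose Q := \matrix_(i < #|'Z_n|, j < #|'Z_n|)
    (echar (enum_val i * enum_val j) / n%:R).
  suff /mulmx1_unit[] : P *m Q = 1%:M by [].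
  apply/matrixP => i j; rewrite !mxE.
  under eq_bigr do rewrite !mxE mulrA -echarD mulrC.
  rewrite -mulr_sumr.
  rewrite (sum_enum_val (fun l => echar (- (enum_val i * l) + l * enum_val j))).
  under eq_bigr => l _ do rewrite -mulNr [l * _]mulrC -mulrDl addrC.
  rewrite sum_echar subr_eq0 (inj_eq enum_val_inj) eq_sym.
  by case: eqP => _; rewrite ?mulr0 // mulVf // pnatr_eq0; lia.
apply: spectrum_unique.
rewrite (@char_poly_similar_diag _ _ P _ (\row_i mu (enum_val i)) uP).
  rewrite big_map big_enum /= [RHS](reindex (@enum_val _ 'Z_n)) /=.
    by apply: eq_bigr => i _; rewrite mxE.
  by apply/onW_bij/enum_val_bij.
apply/matrixP => i j; rewrite mul_diag_mx !mxE.
under eq_bigr do rewrite !mxE /=.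
rewrite (sum_enum_val (fun l => echar (- (enum_val i * l)) * (S (enum_val j - l))%:R)).
rewrite (reindex_inj (can_inj (subKr (enum_val j)))) /= mulr_suml [RHS]big_mkcond /=.
apply: eq_bigr => x _; rewrite subKr; case: ifP; rewrite ?mulr0 // mulr1 -echarD.
by move=> _; congr echar; ring.
Qed.

End AdditiveCharacters.

(** * Ramanujan sums *)

(** The Chinese remainder theorem applied to the p-part of n, where a has to be
    j, and to the rest of n, where 1 will do. *)
Lemma exists_coprime_lift n p j : (0 < n)%N -> prime p -> (p %| n)%N -> ~~ (p %| j)%N ->
  exists2 a, coprime n a & a = j %[mod p].
Proof.
move=> n_gt0 p_pr p_n p_j; pose a := chinese n`_p n`_p^' j 1.
have co_parts : coprime n`_p n`_p^' by apply: coprime_partC.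
have p_dvd : (p %| n`_p)%N.
  by rewrite p_part -[X in (X %| _)%N]expn1 dvdn_exp2l // logn_gt0 mem_primes p_pr n_gt0.
exists a; last first.
  have /(congr1 (modn^~ p)) := chinese_modl co_parts j 1.
  by rewrite /a !modn_dvdm.
rewrite -(partnC p n_gt0) coprimeMl; apply/andP; split; last first.
  by rewrite -coprime_modr (chinese_modr co_parts) coprime_modr coprimen1.
rewrite -coprime_modr (chinese_modl co_parts) coprime_modr.
by rewrite p_part coprimeXl // prime_coprime.
Qed.

Section RamanujanSums.
Variables (n : nat) (n_gt1 : (1 < n)%N).
Implicit Types x k : 'Z_n.

Definition ramanujan_sum k : algC := \sum_(x | x \is a GRing.unit) echar (k * x).

Lemma ramanujan_sum0 : ramanujan_sum 0 = (totient n)%:R.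
Proof.
rewrite -(card_units_Zn n_gt1) -sum1_card natr_sum; apply: eq_bigr => x _.
by rewrite mul0r.
Qed.

Lemma ramanujan_sumMr k a : a \is a GRing.unit ->
  ramanujan_sum (k * a) = ramanujan_sum k.
Proof.
move=> ua; rewrite /ramanujan_sum [RHS](reindex_inj (mulrI ua)) /=.
by apply: eq_big => [x|x _]; rewrite ?unitrMr // mulrA.
Qed.

(** Summing c(jm) over all j < p gives 0, since for each unit x the p-th roots of
    unity echar (m x) ^+ j add up to 0.  The term j = 0 is the totient, and the
    others all equal c(m) because multiplying the frequency by a unit does not
    change the sum and every j prime to p lifts to a unit. *)
Lemma ramanujan_sum_cofactor p m : prime p -> n = (p * m)%N ->
  p.-1%:R * ramanujan_sum m%:R = - (totient n)%:R.
Proof.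
move=> p_pr def_n; have p_gt0 := prime_gt0 p_pr; have p_gt1 := prime_gt1 p_pr.
have m_gt0 : (0 < m)%N by lia.
have m_n : (m < n)%N by rewrite def_n ltn_Pmull.
have p_n : (p %| n)%N by rewrite def_n dvdn_mulr.
have sum0 : \sum_(j < p) ramanujan_sum (m%:R *+ j) = 0.
  rewrite exchange_big big1 //= => x ux.
  set y := echar (m%:R * x).
  rewrite (eq_bigr (fun j : 'I_p => y ^+ j)) => [|j _]; last first.
    by rewrite mulrnAl echarX.
  have y1 : y - 1 != 0.
    rewrite subr_eq0 echar_eq1 // mulrC mulrI_eq0; last exact: mulrI.
    by rewrite natr_Zn_eq0 // gtnNdvd.
  apply: (mulfI y1); rewrite mulr0 -subrX1 -echarX //.
  by rewrite -mulrnAl -mulrnA mulnC -def_n natr_Zn0 // mul0r subrr.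
have eq_sum j : (0 < j < p)%N -> ramanujan_sum (m%:R *+ j) = ramanujan_sum m%:R.
  case/andP=> j_gt0 j_p.
  have [|a co_a a_j] := @exists_coprime_lift n p j (ltnW n_gt1) p_pr p_n.
    by rewrite gtnNdvd.
  have ua : (a%:R : 'Z_n) \is a GRing.unit by rewrite unitZpE.
  rewrite -(ramanujan_sumMr m%:R ua); congr ramanujan_sum.
  have ma_mj : m * a = m * j %[mod n] by rewrite def_n [(p * m)%N]mulnC -!muln_modr a_j.
  by rewrite -natrM -mulrnA -(Zp_nat_mod n_gt1 (m * a)) ma_mj Zp_nat_mod.
move: sum0; rewrite -(prednK p_gt0) big_ord_recl mulr0n ramanujan_sum0.
rewrite (eq_bigr (fun=> ramanujan_sum m%:R)) => [|j _]; last first.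
  by apply: eq_sum; have := ltn_ord j; rewrite /= /bump; lia.
by move/eqP; rewrite addrC addr_eq0 => /eqP <-; rewrite sumr_const card_ord mulr_natl.
Qed.

(** The units are the residues that are not multiples of p. *)
Lemma ramanujan_sum_prime_power p a k : prime p -> n = (p ^ a.+1)%N ->
  ramanujan_sum k = (if k == 0 then n%:R else 0)
                    - (if (p ^ a %| k)%N then (p ^ a)%:R else 0).
Proof.
move=> p_pr def_n; rewrite -(sum_echar n_gt1) (bigID [pred x : 'Z_n | (p %| x)%N]) /=.
rewrite (sum_echar_multiples n_gt1 (m := p ^ a)) -?expnS // addrC addrK.
apply: eq_bigl => x; rewrite unit_Zn // [X in coprime X x]def_n.
by rewrite coprime_pexpl // prime_coprime.
Qed.

(** Inclusion-exclusion on the multiples of p and of q; the only common multiple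
    is 0, which contributes the final 1. *)
Lemma ramanujan_sum_two_primes p q k : prime p -> prime q -> p != q ->
  n = (p * q)%N ->
  ramanujan_sum k = (if k == 0 then n%:R else 0)
    - (if (q %| k)%N then q%:R else 0) - (if (p %| k)%N then p%:R else 0) + 1.
Proof.
move=> p_pr q_pr p_q def_n; have p_gt0 := prime_gt0 p_pr.
rewrite -(sum_echar n_gt1) -(sum_echar_multiples n_gt1 k def_n).
rewrite -(sum_echar_multiples n_gt1 k (etrans def_n (mulnC p q))).
have -> : 1 = \sum_(x : 'Z_n | (p %| x)%N && (q %| x)%N) echar (k * x) :> algC.
  rewrite (big_pred1 0) ?mulr0 // => x.
  rewrite /= val_Zn_eq0 // [X in _ = (X %| x)%N]def_n.
  by rewrite Gauss_dvd // prime_coprime ?dvdn_prime2.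
pose Dp x := (p %| val x)%N; pose Dq x := (q %| val x)%N.
pose S (P : 'Z_n -> bool) := \sum_(x | P x) echar (k * x).
have split_p : S predT = S Dp + S (fun x => ~~ Dp x) by exact: (bigID Dp).
have split_pq : S (fun x => ~~ Dp x) =
    S (fun x => ~~ Dp x && Dq x) + ramanujan_sum k.
  rewrite /S (bigID Dq) /=; congr (_ + _).
  apply: eq_bigl => x; rewrite unit_Zn // [X in coprime X x]def_n.
  by rewrite coprimeMl !prime_coprime.
have split_q : S Dq = S (fun x => Dp x && Dq x) + S (fun x => ~~ Dp x && Dq x).
  rewrite /S (bigID Dp) /=; congr (_ + _);
  by apply: eq_bigl => x /=; rewrite andbC.
change (ramanujan_sum k = S predT - S Dp - S Dq + S (fun x => Dp x && Dq x)).
by rewrite split_p split_pq split_q; ring.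
Qed.

End RamanujanSums.

(** * The unitary Cayley graph, its sum version and its complement *)

Section UnitaryCayleyGraphs.
Variables (n : nat) (n_gt1 : (1 < n)%N).
Implicit Types x k : 'Z_n.

Local Notation G := (@unitary_cayley 'Z_n).
Local Notation Gplus := (@unitary_cayley_sum 'Z_n).
Local Notation Gbar := (graph_compl G).

Lemma norm_echar x : `|echar x| = 1.
Proof.
have e_n : echar x ^+ n = 1.
  by rewrite -echarX // -mulr_natl natr_Zn0 // mul0r echar0.
apply/eqP; rewrite -(pexpr_eq1 (ltnW n_gt1) (normr_ge0 _)).
by rewrite -normrX e_n normr1.
Qed.

Lemma norm_sum_echar_le (S : pred 'Z_n) k :
  `|\sum_(x | S x) echar (k * x)| <= #|S|%:R.
Proof.
apply: le_trans (ler_norm_sum _ _ _) _; rewrite -sum1_card natr_sum.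
by apply: ler_sum => x _; rewrite norm_echar.
Qed.

Lemma degree_mem_spectrum (S : pred 'Z_n) : #|S|%:R \in spectrum (cayley S).
Proof.
rewrite (perm_mem (spectrum_cayley n_gt1 S)); apply/mapP; exists 0.
  by rewrite mem_enum.
by rewrite -sum1_card natr_sum; apply: eq_bigr => x _; rewrite mul0r.
Qed.

(** The degree is an eigenvalue, and bounds the modulus of all of them. *)
Lemma isospectral_degree (S T : pred 'Z_n) :
  perm_eq (spectrum (cayley S)) (spectrum (cayley T)) -> #|S| = #|T|.
Proof.
have le_deg (A B : pred 'Z_n) :
    perm_eq (spectrum (cayley A)) (spectrum (cayley B)) -> (#|A| <= #|B|)%N.
  move=> AB; have := degree_mem_spectrum A.
  rewrite (perm_mem AB) (perm_mem (spectrum_cayley n_gt1 B)) => /mapP[k _ A_k].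
  by rewrite -(ler_nat algC) -normr_nat A_k norm_sum_echar_le.
by move=> ST; apply/eqP; rewrite eqn_leq !le_deg // perm_sym.
Qed.

Definition nonzero_nonunit : pred 'Z_n := fun x => (x != 0) && (x \isn't a GRing.unit).

Lemma graph_compl_unitaryE : Gbar =2 cayley nonzero_nonunit.
Proof.
by move=> v w; rewrite /cayley /nonzero_nonunit /= subr_eq0 eq_sym.
Qed.

Lemma unitary_irrefl : irreflexive G.
Proof. by move=> v; rewrite /unitary_cayley /= subrr unitr0. Qed.

Lemma regular_unitary : regular (totient n) G.
Proof. by rewrite -(card_units_Zn n_gt1); exact: regular_cayley. Qed.

Lemma regular_unitary_sum : regular (totient n) Gplus.
Proof.
move=> v; rewrite -(card_units_Zn n_gt1) -[RHS](card_imset _ (addIr (- v))).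
apply: eq_card => w; rewrite inE /unitary_cayley_sum /=.
apply/idP/imsetP=> [Sw|[x Sx ->]]; last by rewrite addrC subrK.
by exists (v + w); rewrite // addrC addKr.
Qed.

Lemma card_nonzero_nonunit : #|nonzero_nonunit| = (n - totient n).-1.
Proof.
have := cardC [pred x : 'Z_n | x \is a GRing.unit].
rewrite (card_units_Zn n_gt1) (card_Zn n_gt1) (cardD1 0) !inE unitr0 /=.
rewrite (@eq_card _ _ nonzero_nonunit) => [|x]; first lia.
by rewrite !inE.
Qed.

Lemma regular_unitary_compl : regular (n - totient n).-1 Gbar.
Proof.
rewrite -card_nonzero_nonunit => v; rewrite -(regular_cayley _ v).
by apply: eq_card => w; rewrite !inE graph_compl_unitaryE.
Qed.

Lemma spectrum_unitary :
  perm_eq (spectrum G) [seq ramanujan_sum k | k <- enum 'Z_n].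
Proof. exact: spectrum_cayley. Qed.

Lemma spectrum_unitary_compl :
  perm_eq (spectrum Gbar)
    [seq (if k == 0 then n%:R else 0) - 1 - ramanujan_sum k | k <- enum 'Z_n].
Proof.
suff mu_k k : \sum_(x | nonzero_nonunit x) echar (k * x) =
    (if k == 0 then n%:R else 0) - 1 - ramanujan_sum k.
  by rewrite (eq_spectrum graph_compl_unitaryE) -(eq_map mu_k); exact: spectrum_cayley.
rewrite -(sum_echar n_gt1) [\sum_x _](bigD1 0) //= mulr0 echar0 [1 + _]addrC addrK.
rewrite [X in _ = X - _](bigID (fun x => x \is a GRing.unit)) /= addrAC.
rewrite [X in _ = X - _ + _](eq_bigl (fun x => x \is a GRing.unit)) ?subrr ?add0r //.
by move=> x /=; case: eqP => // ->; rewrite unitr0.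
Qed.

(** Both entries count paths of length two; the bijection x |-> - x of the middle
    vertices exchanges the two kinds. *)
Lemma adjacency_sum_square :
  adjacency_mx G *m adjacency_mx G = adjacency_mx Gplus *m adjacency_mx Gplus.
Proof.
apply/matrixP => i j; rewrite !mxE.
under eq_bigr do rewrite !mxE /=; under [RHS]eq_bigr do rewrite !mxE /=.
rewrite (sum_enum_val (fun x => (x - enum_val i \is a GRing.unit)%:R *
  (enum_val j - x \is a GRing.unit)%:R)).
rewrite (sum_enum_val (fun x => (enum_val i + x \is a GRing.unit)%:R *
  (x + enum_val j \is a GRing.unit)%:R)).
rewrite (reindex_inj oppr_inj) /=; apply: eq_bigr => x _.
by rewrite -opprD unitrN opprK [x + enum_val i]addrC [x + enum_val j]addrC.
Qed.

Lemma perm_norm_spectrum_sum :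
  perm_eq [seq `|z| | z <- spectrum G] [seq `|z| | z <- spectrum Gplus].
Proof. exact/perm_norm_spectrum/adjacency_sum_square. Qed.

(** The traces differ: 1/2 carries a loop of the sum graph. *)
Lemma sum_not_isospectral (e : rel 'Z_n) : odd n -> irreflexive e ->
  ~~ perm_eq (spectrum e) (spectrum Gplus).
Proof.
move=> n_odd e_irr; apply/negP => eq_sp.
have : \sum_(z <- spectrum e) z = 0.
  by rewrite sum_spectrum eq_card0 // => v; rewrite !inE e_irr.
move/eqP; rewrite (perm_big _ eq_sp) /= sum_spectrum pnatr_eq0.
move/eqP/card0_eq => loops.
suff u2 : (2%:R : 'Z_n) \is a GRing.unit.
  have := loops 2^-1; rewrite !inE /unitary_cayley_sum /= -mulr2n.
  by rewrite -[_^-1 *+ 2]mulr_natl divrr // unitr1.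
by rewrite unitZpE // coprimen2.
Qed.

(** Integrality is what excludes -1 < z < 0, where the formula fails. *)
Lemma norm1D_int (z : algC) : z \is a Num.int ->
  `|- 1 - z| = `|z| + 1 - (z < 0)%R%:R *+ 2.
Proof.
move=> z_int; have z_real := Rreal_int z_int.
rewrite -opprD normrN [1 + z]addrC.
have [z_ge0|z_lt0] := real_ge0P z_real.
  by rewrite ger0_norm ?addr_ge0 // mul0rn subr0.
have z1_le0 : z + 1 <= 0.
  have := norm_intr_ge1 z_int (ltr0_neq0 z_lt0).
  by rewrite ltr0_norm // lerNr -subr_le0 opprK.
by rewrite ler0_norm // mulr1n; ring.
Qed.

Lemma totient_ltn : (totient n < n)%N.
Proof.
rewrite -(card_units_Zn n_gt1) -[X in (_ < X)%N](card_Zn n_gt1).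
by apply/proper_card/properP; split; [exact/subsetP | exists 0; rewrite ?inE ?unitr0].
Qed.

Lemma energy_unitaryE : energy G = \sum_(k : 'Z_n) `|ramanujan_sum k|.
Proof. by rewrite /energy (perm_big _ spectrum_unitary) big_map big_enum. Qed.

Lemma energy_unitary_complE : energy Gbar =
  (n - totient n).-1%:R + \sum_(k : 'Z_n | k != 0) `|- 1 - ramanujan_sum k|.
Proof.
rewrite /energy (perm_big _ spectrum_unitary_compl) big_map big_enum /=.
rewrite (bigD1 0) //= ramanujan_sum0 //; congr (_ + _).
  have tot_n := totient_ltn.
  by rewrite -addrA -opprD nat1r -natrB // normr_nat subnS.
by apply: eq_bigr => k /negPf->; rewrite add0r.
Qed.

(** Term by term, the complement gains 1 for each c(k) >= 0 with k != 0 and loses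
    1 for each c(k) < 0; the frequency 0 turns the degree of one graph into that
    of the other. *)
Lemma equienergetic_complE : (forall k : 'Z_n, ramanujan_sum k \is a Num.int) ->
  (energy G == energy Gbar) =
  (#|[pred k : 'Z_n | ramanujan_sum k < 0]| == (n - totient n).-1).
Proof.
move=> sum_int; set N := #|_|; set d := _.-1.
have tot_gt0 : (0 < totient n)%N by rewrite totient_gt0 ltnW.
have def_N : N%:R = \sum_(k : 'Z_n | k != 0) (ramanujan_sum k < 0)%R%:R :> algC.
  rewrite /N -sum1_card natr_sum big_mkcond (bigD1 0) //= inE ramanujan_sum0 //.
  rewrite ltrn0 add0r; apply: eq_bigr => k _; rewrite inE; by case: ifP.
have card_nz : \sum_(k : 'Z_n | k != 0) 1 = (totient n + d)%:R :> algC.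
  rewrite (eq_bigl [in predC1 (0 : 'Z_n)]) // sumr_const cardC1 card_Zn //.
  by congr _%:R; have := totient_ltn; rewrite /d; lia.
have -> : energy Gbar = energy G + (d%:R - N%:R) *+ 2.
  rewrite energy_unitary_complE energy_unitaryE -/d.
  under eq_bigr do rewrite norm1D_int //.
  rewrite sumrB big_split /= card_nz sumrMnl -def_N.
  rewrite [in RHS](bigD1 0) //= ramanujan_sum0 // normr_nat natrD; ring.
rewrite -subr_eq0 opprD addrA subrr add0r oppr_eq0 mulrn_eq0 /= subr_eq0 eqr_nat.
by rewrite eq_sym.
Qed.

End UnitaryCayleyGraphs.

(** * Prime powers and products of two primes *)

Section Cases.
Variables (n : nat) (n_gt1 : (1 < n)%N).
Implicit Types x k : 'Z_n.

Local Notation G := (@unitary_cayley 'Z_n).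
Local Notation Gplus := (@unitary_cayley_sum 'Z_n).
Local Notation Gbar := (graph_compl G).

Lemma card_nonzero_multiples p m : n = (p * m)%N ->
  #|[pred x : 'Z_n | (x != 0) && (p %| x)%N]| = m.-1.
Proof.
move=> def_n; rewrite -(card_multiples n_gt1 def_n) [in RHS](cardD1 0) inE dvdn0.
by apply: eq_card => x; rewrite !inE.
Qed.

Lemma ramanujan_sum_prime_power_nz p a k : prime p -> n = (p ^ a.+1)%N -> k != 0 ->
  ramanujan_sum k = - ((p ^ a) * (p ^ a %| k))%:R.
Proof.
move=> p_pr def_n /negPf k0.
rewrite (ramanujan_sum_prime_power n_gt1 k p_pr def_n) k0.
by rewrite sub0r; case: ifP; rewrite ?muln1 ?muln0.
Qed.

(** The negative sums are at the p - 1 nonzero multiples of p ^ a, whereas the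
    complement has degree p ^ a - 1. *)
Lemma equienergetic_prime_power p a : prime p -> n = (p ^ a.+1)%N ->
  (energy G == energy Gbar) = (a == 1)%N.
Proof.
move=> p_pr def_n; have p_gt1 := prime_gt1 p_pr.
have sumE k := @ramanujan_sum_prime_power_nz p a k p_pr def_n.
rewrite equienergetic_complE // => [|k]; last first.
  have [->|/sumE->] := eqVneq k 0; first by rewrite ramanujan_sum0 // rpred_nat.
  by rewrite rpredN rpred_nat.
have -> : #|[pred k : 'Z_n | ramanujan_sum k < 0]| = p.-1.
  rewrite -(@card_nonzero_multiples (p ^ a) p) -?expnSr //.
  apply: eq_card => k; rewrite !inE; have [->|/sumE->] := eqVneq k 0.
    by rewrite ramanujan_sum0 // ltrn0.
  by rewrite oppr_lt0 ltr0n muln_gt0 expn_gt0 (ltnW p_gt1) lt0b.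
have pa_gt0 : (0 < p ^ a)%N by rewrite expn_gt0 ltnW.
have -> : (n - totient n = p ^ a)%N.
  by rewrite def_n totient_pfactor // expnS -mulnBl; nia.
by rewrite -(eqn_exp2l a 1 p_gt1) expn1; lia.
Qed.

Lemma ramanujan_sum_two_primes_nz p q k : prime p -> prime q -> p != q ->
    n = (p * q)%N -> k != 0 ->
  ramanujan_sum k =
    if (p %| k)%N then - p.-1%:R else if (q %| k)%N then - q.-1%:R else 1.
Proof.
move=> p_pr q_pr p_q def_n k0.
rewrite (ramanujan_sum_two_primes n_gt1 k p_pr q_pr p_q def_n) (negPf k0).
have predE r : prime r -> - r.-1%:R = 1 - r%:R :> algC.
  by case: r => // r _; rewrite -[r.+1%:R]natr1; ring.
have co_pq : coprime p q by rewrite prime_coprime // dvdn_prime2.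
have : ~~ ((p %| k) && (q %| k))%N.
  by rewrite -Gauss_dvd // -[X in (X %| _)%N]def_n -val_Zn_eq0.
by case: ifP => _; case: ifP => // _ _; rewrite ?predE //; ring.
Qed.

Lemma totient_two_primes p q : prime p -> prime q -> p != q -> n = (p * q)%N ->
  totient n = (p.-1 * q.-1)%N.
Proof.
move=> p_pr q_pr p_q ->.
by rewrite totient_coprime ?totient_prime // prime_coprime // dvdn_prime2.
Qed.

Lemma degree_compl_two_primes p q : prime p -> prime q -> p != q ->
  n = (p * q)%N -> (n - totient n).-1 = (p + q - 2)%N.
Proof.
move=> p_pr q_pr p_q def_n; rewrite (totient_two_primes p_pr q_pr p_q def_n) def_n.
by have := prime_gt1 p_pr; have := prime_gt1 q_pr; nia.
Qed.

(** The negative sums are at the nonzero multiples of p or of q: there are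
    (q - 1) + (p - 1) of them, the degree of the complement. *)
Lemma equienergetic_two_primes p q : prime p -> prime q -> p != q ->
  n = (p * q)%N -> energy G == energy Gbar.
Proof.
move=> p_pr q_pr p_q def_n.
have p_gt1 := prime_gt1 p_pr; have q_gt1 := prime_gt1 q_pr.
have co_pq : coprime p q by rewrite prime_coprime // dvdn_prime2.
have sumE k := @ramanujan_sum_two_primes_nz p q k p_pr q_pr p_q def_n.
rewrite equienergetic_complE // => [|k]; last first.
  have [->|/sumE->] := eqVneq k 0; first by rewrite ramanujan_sum0 // rpred_nat.
  by do 2?case: ifP; rewrite ?rpredN ?rpred_nat ?rpred1.
have -> : ((n - totient n).-1 = q.-1 + p.-1)%N.
  by rewrite (degree_compl_two_primes p_pr q_pr p_q def_n); lia.
rewrite -(card_nonzero_multiples def_n).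
rewrite -(card_nonzero_multiples (etrans def_n (mulnC p q))).
rewrite -cardUI [X in (_ == _ + X)%N]eq_card0 ?addn0 => [|k]; last first.
  rewrite !inE; case: eqVneq => //= k0; apply: contraNF k0.
  by rewrite -Gauss_dvd // -[X in (X %| _)%N]def_n -val_Zn_eq0.
apply/eqP/eq_card => k; rewrite !inE; have [->|/sumE->] := eqVneq k 0.
  by rewrite ramanujan_sum0 // ltrn0.
case: ifP => _ /=; first by rewrite oppr_lt0 ltr0n; lia.
by case: ifP => _ /=; rewrite ?oppr_lt0 ?ltr0n ?ltr10 //; lia.
Qed.

(** The Ramanujan bound at the eigenvalue - totient n / (p - 1); for p > 2 it is
    not of maximal modulus. *)
Lemma ramanujan_unitary_le p m : prime p -> odd p -> n = (p * m)%N ->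
  ramanujan G -> (totient n ^ 2 <= 4 * p.-1 ^ 2 * (totient n).-1)%N.
Proof.
move=> p_pr p_odd def_n /(ramanujanP 0 (regular_unitary n_gt1)) ramG.
have p_gt2 : (2 < p)%N by rewrite odd_prime_gt2.
have tot_gt0 : (0 < totient n)%N by rewrite totient_gt0 ltnW.
have := ramanujan_sum_cofactor n_gt1 p_pr def_n.
move/(congr1 Num.norm); rewrite normrN normrM !normr_nat.
set z := ramanujan_sum _ => def_z.
have zG : z \in spectrum G.
  by rewrite (perm_mem (spectrum_unitary n_gt1)) map_f ?mem_enum.
have /(ramG z zG) : `|z| != (totient n)%:R.
  apply: contraTneq (p_gt2) => eq_z; move/eqP: def_z.
  by rewrite eq_z -natrM eqr_nat; nia.
rewrite -(ler_pM2l (_ : 0 < p.-1%:R)) ?ltr0n; last by lia.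
rewrite def_z -ler_sqr ?nnegrE ?mulr_ge0 ?sqrtC_ge0 ?subr_ge0 ?ler1n ?ler0n //.
rewrite !exprMn sqrtCK -[in X in _ <= X](prednK tot_gt0) -[_.-1.+1%:R]natr1 addrK.
by rewrite -!natrX -!natrM ler_nat; lia.
Qed.

(** The Ramanujan bound of the complement at the eigenvalue q - 2, which comes
    from the Ramanujan sum 1 - q at the frequency q. *)
Lemma ramanujan_compl_le p q : prime p -> prime q -> (2 < p < q)%N ->
  n = (p * q)%N -> ramanujan Gbar -> ((q - 2) ^ 2 <= 4 * (p + q - 3))%N.
Proof.
move=> p_pr q_pr /andP[p_gt2 p_q] def_n.
have pq_neq : p != q by rewrite ltn_eqF.
have tot_n := totient_two_primes p_pr q_pr pq_neq def_n.
have deg := degree_compl_two_primes p_pr q_pr pq_neq def_n.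
have := regular_unitary_compl n_gt1; rewrite deg => reg.
move/(ramanujanP 0 reg) => /(_ (q - 2)%:R).
rewrite normr_nat eqr_nat ramanujan_boundE; last by lia.
have -> : (p + q - 2).-1 = (p + q - 3)%N by lia.
apply; last by lia.
rewrite (perm_mem (spectrum_unitary_compl n_gt1)); apply/mapP.
exists q%:R; first by rewrite mem_enum.
have q0 : (q%:R : 'Z_n) != 0 by rewrite natr_Zn_eq0 // gtnNdvd //; nia.
have p1 : p.-1%:R != 0 :> algC by rewrite pnatr_eq0; lia.
rewrite (negPf q0); have /eqP := ramanujan_sum_cofactor n_gt1 p_pr def_n.
rewrite tot_n natrM -mulrN (inj_eq (mulfI p1)) => /eqP->.
have -> : q.-1 = (q - 2).+1 by lia.
by rewrite -[(q - 2).+1%:R]natr1; ring.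
Qed.

Lemma ramanujan_prime_square p : prime p -> odd p -> n = (p ^ 2)%N ->
  ramanujan G /\ ramanujan Gbar.
Proof.
move=> p_pr p_odd def_n; have p_gt2 : (2 < p)%N by rewrite odd_prime_gt2.
have tot_n : totient n = (p.-1 * p)%N by rewrite def_n totient_pfactor // expn1.
have deg : ((n - totient n).-1 = p.-1)%N by rewrite tot_n def_n; nia.
have sumE k : k != 0 -> ramanujan_sum k = - (p * (p %| k))%:R.
  by move/(ramanujan_sum_prime_power_nz p_pr def_n); rewrite expn1.
split.
  apply/(ramanujanP 0 (regular_unitary n_gt1)) => z.
  rewrite (perm_mem (spectrum_unitary n_gt1)) => /mapP[k _ ->].
  have [->|/sumE->] := eqVneq k 0; first by rewrite ramanujan_sum0 // normr_nat eqxx.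
  rewrite normrN normr_nat ramanujan_boundE; last by rewrite tot_n; nia.
  by rewrite tot_n => _; case: (p %| k)%N; nia.
have := regular_unitary_compl n_gt1; rewrite deg => reg.
apply/(ramanujanP 0 reg) => z.
rewrite (perm_mem (spectrum_unitary_compl n_gt1)) => /mapP[k _ ->].
have [->|k0] := eqVneq k 0.
  rewrite ramanujan_sum0 // -addrA -opprD nat1r -natrB; last exact: totient_ltn.
  by rewrite subnS deg normr_nat eqxx.
rewrite sub0r -[- 1 - _]opprD normrN sumE //.
have [|_] := boolP (p %| k)%N; rewrite ?muln1 ?muln0 ?subr0.
  rewrite -normrN opprD opprK addrC -[X in `|X%:R - 1|](prednK (ltnW (ltnW p_gt2))).
  by rewrite -[_.-1.+1%:R]natr1 addrK normr_nat eqxx.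
by rewrite normr1 (ramanujan_boundE 1); lia.
Qed.

(** Apart from the degrees, the eigenvalues of the two graphs are 1 - p, 1 - q, 1
    and p - 2, q - 2, -2, so that only those of q matter. *)
Lemma ramanujan_two_primes p q : prime p -> prime q -> (2 < p < q)%N -> n = (p * q)%N ->
  (q.-1 ^ 2 <= 4 * (p.-1 * q.-1).-1)%N -> ((q - 2) ^ 2 <= 4 * (p + q - 3))%N ->
  ramanujan G /\ ramanujan Gbar.
Proof.
move=> p_pr q_pr /andP[p_gt2 p_q] def_n le_G le_Gbar.
have pq_neq : p != q by rewrite ltn_eqF.
have tot_n := totient_two_primes p_pr q_pr pq_neq def_n.
have deg := degree_compl_two_primes p_pr q_pr pq_neq def_n.
have sumE k := @ramanujan_sum_two_primes_nz p q k p_pr q_pr pq_neq def_n.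
split.
  apply/(ramanujanP 0 (regular_unitary n_gt1)) => z.
  rewrite (perm_mem (spectrum_unitary n_gt1)) => /mapP[k _ ->].
  have [->|/sumE->] := eqVneq k 0; first by rewrite ramanujan_sum0 // normr_nat eqxx.
  have bound m : (m <= q.-1)%N -> m%:R <= 2 * sqrtC ((totient n)%:R - 1) :> algC.
    move=> m_q; rewrite ramanujan_boundE tot_n; last by rewrite muln_gt0; lia.
    by apply: leq_trans le_G; rewrite leq_sqr.
  case: ifP => _; last case: ifP => _; rewrite ?normrN ?normr_nat ?normr1 => _.
  - by apply: bound; lia.
  - exact: bound.
  - by apply: (bound 1); lia.
have := regular_unitary_compl n_gt1; rewrite deg => reg.
apply/(ramanujanP 0 reg) => z.
rewrite (perm_mem (spectrum_unitary_compl n_gt1)) => /mapP[k _ ->].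
have [->|k0] := eqVneq k 0.
  rewrite ramanujan_sum0 // -addrA -opprD nat1r -natrB; last exact: totient_ltn.
  by rewrite subnS deg normr_nat eqxx.
have pred2E r : (2 < r)%N -> 0 - 1 - - r.-1%:R = (r - 2)%:R :> algC.
  case: r => [|[|r]] // _; rewrite -[r.+2.-1%:R]natr1 !subSS subn0; ring.
have bound m : (m <= q - 2)%N -> m%:R <= 2 * sqrtC ((p + q - 2)%:R - 1) :> algC.
  move=> m_q; rewrite ramanujan_boundE; last by lia.
  have -> : ((p + q - 2).-1 = p + q - 3)%N by lia.
  by apply: leq_trans le_Gbar; rewrite leq_sqr.
rewrite sumE //; case: ifP => _; last case: ifP => _.
- by rewrite pred2E // normr_nat => _; apply: bound; lia.
- by rewrite pred2E ?normr_nat => [_|]; [exact: bound | lia].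
- rewrite sub0r -opprD normrN (_ : 1 + 1 = 2%:R) // normr_nat => _.
  by apply: bound; lia.
Qed.

Lemma ramanujan_unitary_sum : ramanujan G -> ramanujan Gplus.
Proof.
apply: (ramanujan_norm_spectrum 0 (regular_unitary n_gt1) (regular_unitary_sum n_gt1)).
exact: perm_norm_spectrum_sum.
Qed.

End Cases.

(** * Integers with a small totient *)

Section TotientBound.
Local Open Scope nat_scope.

Lemma totient_mul_prime p m : prime p -> 0 < m ->
  totient (p * m) = (if p %| m then p else p.-1) * totient m.
Proof.
move=> p_pr m_gt0; have [m' co_m' def_m] := pfactor_coprime p_pr m_gt0.
have co e : coprime m' (p ^ e) by rewrite coprimeXr // coprime_sym.
have -> : (p %| m) = (0 < logn p m) by rewrite logn_gt0 mem_primes p_pr m_gt0.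
rewrite [in LHS]def_m [in totient m]def_m; move: (logn p m) => e.
rewrite mulnCA -expnS !totient_coprime //.
rewrite totient_pfactor //=; case: e => [|e] /=.
  by rewrite expn0 (erefl : totient 1 = 1) !muln1 mulnC.
by rewrite totient_pfactor //= expnS; nia.
Qed.

(** With three prime factors p <= q <= r, possibly equal, the totient is at least
    (p-1)(q-1)(r-1), which is at least 4 (p-1)^2 once p >= 5.  For p = 3 this
    estimate falls short when q and r are 3 as well, and one has to use that a
    repeated prime p contributes p in place of p - 1. *)
Lemma few_primes_of_totient_le n p : odd n -> prime p -> p %| n ->
    (forall r, prime r -> r %| n -> p <= r) ->
    totient n ^ 2 <= 4 * p.-1 ^ 2 * (totient n).-1 ->
  [\/ n = p, n = p ^ 2 | exists q, [/\ prime q, p < q & n = p * q]].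
Proof.
move=> n_odd p_pr p_n p_min bound; have n_gt0 := odd_gt0 n_odd.
have tot_gt0 : 0 < totient n by rewrite totient_gt0.
have {bound} lt_tot : totient n < 4 * p.-1 ^ 2 by move: (4 * _) bound => c; nia.
have p_gt2 : 2 < p by rewrite odd_prime_gt2 // (dvdn_odd p_n).
have /dvdnP[m def_n] := p_n; rewrite mulnC in def_n.
have m_gt0 : 0 < m by lia.
have [m1|m_gt1] := leqP m 1.
  by constructor 1; rewrite def_n (_ : m = 1) ?muln1 //; lia.
pose q := pdiv m; have q_pr : prime q := pdiv_prime m_gt1.
have p_q : p <= q by rewrite p_min // def_n dvdn_mull // pdiv_dvd.
have /dvdnP[t def_m] := pdiv_dvd m; rewrite -/q mulnC in def_m.
have t_gt0 : 0 < t by lia.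
have [t1|t_gt1] := leqP t 1.
  have {}def_m : m = q by rewrite def_m (_ : t = 1) ?muln1 //; lia.
  have [p_lt_q|p_ge_q] := ltnP p q.
    by constructor 3; exists q; split=> //; rewrite -def_m.
  by constructor 2; rewrite def_n -mulnn; congr (_ * _); lia.
pose r := pdiv t; have r_pr : prime r := pdiv_prime t_gt1.
have q_r : q <= r.
  apply: pdiv_min_dvd; rewrite ?prime_gt1 //.
  by rewrite def_m dvdn_mull // pdiv_dvd.
have /dvdnP[u def_t] := pdiv_dvd t; rewrite -/r mulnC in def_t.
have u_gt0 : 0 < u by lia.
(* Between the primes 3 and 5 only 4 has to be ruled out. *)
have not4 s : prime s -> s != 4 by move=> s_pr; apply: contraTneq s_pr => ->.
have := not4 p p_pr; have := not4 q q_pr; have := not4 r r_pr.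
have q_dvd : p = q -> p %| m by move=> ->; exact: pdiv_dvd.
have r_dvd : q = r -> q %| t by move=> ->; exact: pdiv_dvd.
have tot_u : 0 < totient u by rewrite totient_gt0.
have : totient n = (if p %| m then p else p.-1) * ((if q %| t then q else q.-1) *
    ((if r %| u then r else r.-1) * totient u)).
  by rewrite -totient_mul_prime // -def_t -totient_mul_prime // -def_m
             -totient_mul_prime // -def_n.
set A := if p %| m then _ else _; set B := if q %| t then _ else _.
set C := if r %| u then _ else _ => def_tot.
have A_p : p = q -> A = p by move/q_dvd; rewrite /A => ->.
have B_q : q = r -> B = q by move/r_dvd; rewrite /B => ->.
have A_ge : p.-1 <= A by rewrite /A; case: ifP => _ //; exact: leq_pred.
have B_ge : q.-1 <= B by rewrite /B; case: ifP => _ //; exact: leq_pred.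
have C_ge : r.-1 <= C by rewrite /C; case: ifP => _ //; exact: leq_pred.
move=> r4 q4 p4; exfalso; suff : 4 * p.-1 ^ 2 <= totient n by lia.
have {def_tot} : A * B * C <= totient n by rewrite def_tot !mulnA leq_pmulr.
apply: leq_trans; clearbody A B C; clear -p_gt2 p_q q_r A_p B_q A_ge B_ge C_ge p4 q4 r4.
have [p3|p5] : p = 3 \/ 5 <= p by lia.
  subst p; have [q3|q5] : q = 3 \/ 5 <= q by lia.
    have {A_p} A3 : A = 3 by rewrite A_p.
    have [r3|r5] : r = 3 \/ 5 <= r by lia.
      have B3 : B = 3 by rewrite B_q; lia.
      by rewrite A3 B3; lia.
    by apply: (@leq_trans (3 * 2 * 4)); rewrite ?leq_mul //; lia.
  by apply: (@leq_trans (2 * 4 * 4)); rewrite ?leq_mul //; lia.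
apply: (@leq_trans (p.-1 * p.-1 * p.-1)); last by rewrite !leq_mul //; lia.
by rewrite -mulnn mulnC leq_mul //; lia.
Qed.

End TotientBound.

(** * Maximal ideals and locality *)

Section Ideals.
Variables (n : nat) (n_gt1 : (1 < n)%N).

Lemma natr_in_multiples p m : (p %| n)%N ->
  (p %| (m%:R : 'Z_n))%N = (p %| m)%N.
Proof. by move=> p_n; rewrite val_Zp_nat // /dvdn modn_dvdm. Qed.

Lemma idealr_closed_multiples p : (1 < p)%N -> (p %| n)%N ->
  idealr_closed [set x : 'Z_n | (p %| x)%N].
Proof.
move=> p_gt1 p_n; split; rewrite ?inE ?dvdn0 //.
  by rewrite -[1]/(1%:R) natr_in_multiples // dvdn1; lia.
move=> a u v; rewrite !inE; case/dvdnP: p_n => m; rewrite mulnC => def_n.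
rewrite !(dvd_val_Zn n_gt1 _ def_n) => /eqP u0 /eqP v0.
by rewrite mulrDr mulrCA u0 v0 mulr0 addr0.
Qed.

(** An ideal that contains p and some x prime to p contains 1, by Bezout. *)
Lemma maximal_ideal_multiples p : prime p -> (p %| n)%N ->
  maximal_ideal [set x : 'Z_n | (p %| x)%N].
Proof.
move=> p_pr p_n; split; first by apply: idealr_closed_multiples; rewrite ?prime_gt1.
move=> J [J0 J1 J_lin] IJ; apply/eqP; rewrite eqEsubset IJ andbT.
apply/subsetP => x Jx; rewrite inE; apply: contraNT J1 => p_x.
have [a _] := Bezoutl x (prime_gt0 p_pr).
rewrite (eqP (_ : coprime p x)) ?prime_coprime // => p_ax.
have -> : 1 = - a%:R * x + (1 + a * x)%N%:R :> 'Z_n.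
  by rewrite natrD natrM natr_Zp mulNr addrCA addNr addr0.
by apply/J_lin/(subsetP IJ) => //; rewrite inE natr_in_multiples.
Qed.

(** All elements outside the ideal of multiples of p are units. *)
Lemma local_ring_prime_power p a : prime p -> n = (p ^ a.+1)%N -> local_ring 'Z_n.
Proof.
move=> p_pr def_n; have p_n : (p %| n)%N by rewrite def_n expnS dvdn_mulr.
exists [set x : 'Z_n | (p %| x)%N]; split; first exact: maximal_ideal_multiples.
move=> I [[I0 I1 I_lin] I_max]; apply: I_max.
  by apply: idealr_closed_multiples; rewrite ?prime_gt1.
apply/subsetP => x Ix; rewrite inE; apply: contraNT I1 => p_x.
suff ux : x \is a GRing.unit by rewrite -(mulVr ux) -[_ * _]addr0 I_lin.
by rewrite unit_Zn // [X in coprime X _]def_n coprime_pexpl // prime_coprime.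
Qed.

Lemma not_local_two_primes p q : prime p -> prime q -> p != q ->
  (p %| n)%N -> (q %| n)%N -> ~ local_ring 'Z_n.
Proof.
move=> p_pr q_pr p_q p_n q_n [I [_ I_uniq]].
have Ip := I_uniq _ (maximal_ideal_multiples p_pr p_n).
have Iq := I_uniq _ (maximal_ideal_multiples q_pr q_n).
have : (p%:R : 'Z_n) \in I by rewrite Ip inE natr_in_multiples.
by rewrite Iq inE natr_in_multiples // dvdn_prime2 // eq_sym (negPf p_q).
Qed.

End Ideals.

(** * Isomorphisms *)

Lemma ring_isomorphic_refl (R : nzRingType) : ring_isomorphic R R.
Proof. by exists idfun; exists id. Qed.

Lemma ring_isomorphic_chinese p q : (1 < p)%N -> (1 < q)%N -> coprime p q ->
  ring_isomorphic 'Z_(p * q) ('Z_p * 'Z_q)%type.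
Proof.
move=> p_gt1 q_gt1 co_pq; have pq_gt1 : (1 < p * q)%N by nia.
pose f (x : 'Z_(p * q)) : 'Z_p * 'Z_q := (x%:R, x%:R).
have f_nat m : f m%:R = (m%:R, m%:R).
  rewrite /f val_Zp_nat //; congr (_, _).
    by rewrite -[LHS](Zp_nat_mod p_gt1) modn_dvdm ?dvdn_mulr // Zp_nat_mod.
  by rewrite -[LHS](Zp_nat_mod q_gt1) modn_dvdm ?dvdn_mull // Zp_nat_mod.
have fD x y : f (x + y) = f x + f y.
  by rewrite -[x]natr_Zp -[y]natr_Zp -natrD !f_nat !natrD.
have f_add : {morph f : x y / x - y}.
  by move=> x y; rewrite -[in RHS](subrK y x) (fD (x - y)) addrK.
have f_mul : monoid_morphism f.
  split=> [|x y]; first by rewrite -[1]/(1%:R) f_nat.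
  by rewrite -[x]natr_Zp -[y]natr_Zp -natrM !f_nat !natrM.
pose fA := GRing.isZmodMorphism.Build _ _ f f_add.
pose fM := GRing.isMonoidMorphism.Build _ _ f f_mul.
pose fR : {rmorphism 'Z_(p * q) -> ('Z_p * 'Z_q)%type} := HB.pack f fA fM.
exists fR; apply: inj_card_bij; last first.
  by rewrite card_prod !card_Zn.
move=> x y [/(congr1 val) xy_p /(congr1 val) xy_q].
rewrite /= !val_Zp_nat // in xy_p xy_q.
rewrite -[x]natr_Zp -[y]natr_Zp -(Zp_nat_mod pq_gt1 x).
have /eqP -> : x == y %[mod p * q] by rewrite chinese_remainder // xy_p xy_q !eqxx.
by rewrite Zp_nat_mod.
Qed.

(** * Classification *)

Lemma pairwise_seq3 T (r : rel T) a b c :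
  pairwise r [:: a; b; c] = [&& r a b, r a c & r b c].
Proof. by rewrite /= !andbT andbA. Qed.

Section Triple.
Variables (n : nat) (n_gt1 : (1 < n)%N) (n_odd : odd n).

Local Notation G := (@unitary_cayley 'Z_n).
Local Notation Gplus := (@unitary_cayley_sum 'Z_n).
Local Notation Gbar := (graph_compl G).

Lemma equienergetic_tripleE :
  equienergetic [:: G; Gplus; Gbar] = (energy G == energy Gbar).
Proof.
rewrite /equienergetic pairwise_seq3 -(energy_norm_spectrum (perm_norm_spectrum_sum _)).
by rewrite eqxx andbb.
Qed.

Lemma non_isospectral_triple :
  totient n != (n - totient n).-1 -> non_isospectral [:: G; Gplus; Gbar].
Proof.
move=> deg_neq.
have G_Gplus := sum_not_isospectral n_gt1 n_odd (@unitary_irrefl n).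
have Gplus_Gbar : ~~ perm_eq (spectrum Gplus) (spectrum Gbar).
  rewrite perm_sym; apply: sum_not_isospectral => // v.
  by rewrite /graph_compl /= eqxx.
have G_Gbar : ~~ perm_eq (spectrum G) (spectrum Gbar).
  rewrite -(card_nonzero_nonunit n_gt1) -(card_units_Zn n_gt1) in deg_neq.
  rewrite (eq_spectrum (@graph_compl_unitaryE n)); apply: contra deg_neq => GGbar.
  by apply/eqP; exact: (isospectral_degree n_gt1 GGbar).
rewrite /non_isospectral pairwise_seq3; apply/and3P; split.
- exact: G_Gplus.
- exact: G_Gbar.
- exact: Gplus_Gbar.
Qed.

(** The purely numerical form of the classification. *)
Lemma unitary_triple_iff :
  (equienergetic [:: G; Gplus; Gbar] /\ non_isospectral [:: G; Gplus; Gbar]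
   /\ ramanujan G /\ ramanujan Gplus /\ ramanujan Gbar)
  <-> (exists2 p, prime p & n = (p ^ 2)%N) \/ n \in [:: 15; 21; 35]%N.
Proof.
split=> [[]|].
  rewrite equienergetic_tripleE => eq_energy [_ [ramG [_ ramGbar]]].
  have p_pr := pdiv_prime n_gt1; have p_n := pdiv_dvd n.
  have p_min r : prime r -> (r %| n)%N -> (pdiv n <= r)%N.
    by move=> r_pr; apply: pdiv_min_dvd; apply: prime_gt1.
  have p_odd := dvdn_odd p_n n_odd.
  have p_gt2 := odd_prime_gt2 p_odd p_pr.
  move: (pdiv n) => p in p_pr p_n p_min p_odd p_gt2 *.
  have /dvdnP[m] := p_n; rewrite mulnC => def_n.
  have le_G := ramanujan_unitary_le n_gt1 p_pr p_odd def_n ramG.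
  have [n_p|n_p2|[q [q_pr p_q n_pq]]] :=
    few_primes_of_totient_le n_odd p_pr p_n p_min le_G.
  - by rewrite (@equienergetic_prime_power n n_gt1 p 0) ?expn1 in eq_energy.
  - by left; exists p.
  have q_odd : odd q by rewrite (dvdn_odd _ n_odd) // n_pq dvdn_mull.
  have p2_lt_q : (2 < p < q)%N by rewrite p_gt2.
  have le_Gbar := ramanujan_compl_le n_gt1 p_pr q_pr p2_lt_q n_pq ramGbar.
  right; rewrite n_pq; clear -p_pr q_pr p_q p_gt2 le_Gbar p_odd q_odd.
  (* Parity doubles the gap, and (q - 2)^2 <= 4 (2 q - 5) bounds q. *)
  have p2_q : (p + 2 <= q)%N.
    suff : q != p.+1 by lia.
    by apply: contraTneq q_odd => ->; rewrite /= p_odd.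
  have q_le9 : (q <= 9)%N.
    have [s def_q] : exists s, q = s.+2 by exists (q - 2)%N; lia.
    rewrite def_q subSS subSS subn0 -mulnn in le_Gbar; rewrite def_q; nia.
  have q57 : q = 5 \/ q = 7.
    have [|[|[|[|]]]] : q = 5 \/ q = 6 \/ q = 7 \/ q = 8 \/ q = 9 by lia.
    - by left.
    - by move=> q_eq; rewrite q_eq in q_pr.
    - by right.
    - by move=> q_eq; rewrite q_eq in q_pr.
    - by move=> q_eq; rewrite q_eq in q_pr.
  have p4 : p != 4 by apply: contraTneq p_pr => ->.
  case: q57 p2_q => ->; have [->|[->|]] // : p = 3 \/ p = 5 \/ (5 < p)%N by lia.
    by lia.
  by lia.
move=> cases.
suff [deg_neq [eq_energy [ramG ramGbar]]] : totient n != (n - totient n).-1 /\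
    energy G == energy Gbar /\ ramanujan G /\ ramanujan Gbar.
  split; first by rewrite equienergetic_tripleE; exact: eq_energy.
  split; first exact: non_isospectral_triple deg_neq.
  split; first exact: ramG.
  by split; [exact: ramanujan_unitary_sum ramG | exact: ramGbar].
case: cases => [[p p_pr def_n]|n_in].
  have p_odd : odd p by rewrite (dvdn_odd _ n_odd) // def_n dvdn_mulr.
  rewrite (@equienergetic_prime_power n n_gt1 p 1) //.
  split; last by split; [exact: isT | exact: ramanujan_prime_square def_n].
  have := odd_prime_gt2 p_odd p_pr; rewrite def_n totient_pfactor // expn1 -mulnn.
  by move=> p_gt2; apply/eqP; nia.
have [p [q [p_pr q_pr pq def_n [deg_neq le_G le_Gbar]]]] : exists p q,
    [/\ prime p, prime q, (2 < p < q)%N, n = (p * q)%N &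
     [/\ totient n != (n - totient n).-1, (q.-1 ^ 2 <= 4 * (p.-1 * q.-1).-1)%N
       & ((q - 2) ^ 2 <= 4 * (p + q - 3))%N]].
  move: n_in; rewrite !inE => /or3P[]/eqP->.
  - by exists 3%N, 5%N.
  - by exists 3%N, 7%N.
  - by exists 5%N, 7%N.
split; first exact: deg_neq.
split; last exact: ramanujan_two_primes def_n le_G le_Gbar.
apply: equienergetic_two_primes def_n => //.
by case/andP: pq => _ /ltn_eqF ->.
Qed.

End Triple.

Theorem corollary5p8 (n : nat) (n_gt1 : (1 < n)%N) (n_odd : odd n) :
  (equienergetic [:: @unitary_cayley 'Z_n; @unitary_cayley_sum 'Z_n;
                     graph_compl (@unitary_cayley 'Z_n)]
   /\ non_isospectral [:: @unitary_cayley 'Z_n; @unitary_cayley_sum 'Z_n;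
                          graph_compl (@unitary_cayley 'Z_n)]
   /\ ramanujan (@unitary_cayley 'Z_n)
   /\ ramanujan (@unitary_cayley_sum 'Z_n)
   /\ ramanujan (graph_compl (@unitary_cayley 'Z_n)))
  <->
  ((local_ring 'Z_n /\
    exists p : nat, prime p /\ odd p /\ ring_isomorphic 'Z_n 'Z_(p ^ 2))
   \/
   (~ local_ring 'Z_n /\
    (ring_isomorphic 'Z_n ('Z_3 * 'Z_5)%type
     \/ ring_isomorphic 'Z_n ('Z_3 * 'Z_7)%type
     \/ ring_isomorphic 'Z_n ('Z_5 * 'Z_5)%type
     \/ ring_isomorphic 'Z_n ('Z_5 * 'Z_7)%type
     \/ ring_isomorphic 'Z_n ('Z_7 * 'Z_7)%type
     \/ ring_isomorphic 'Z_n ('Z_11 * 'Z_11)%type))).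
Proof.
apply: iff_trans (unitary_triple_iff n_gt1 n_odd) _.
have iso_card p q : (1 < p)%N -> (1 < q)%N ->
    ring_isomorphic 'Z_n ('Z_p * 'Z_q)%type -> n = (p * q)%N.
  move=> p1 q1 [f /(@bij_eq_card 'Z_n ('Z_p * 'Z_q)%type)].
  by rewrite card_prod !card_Zn.
split.
  case=> [[p p_pr def_n]|n_in].
    left; split; first exact: local_ring_prime_power p_pr def_n.
    exists p; split=> //; split; last by rewrite -def_n; exact: ring_isomorphic_refl.
    by rewrite (dvdn_odd _ n_odd) // def_n dvdn_mulr.
  right; split.
    move: n_in; rewrite !inE => /or3P[]/eqP def_n.
    - by apply: (@not_local_two_primes n n_gt1 3 5); rewrite ?def_n.
    - by apply: (@not_local_two_primes n n_gt1 3 7); rewrite ?def_n.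
    - by apply: (@not_local_two_primes n n_gt1 5 7); rewrite ?def_n.
  move: n_in; rewrite !inE => /or3P[]/eqP->.
  - by left; apply: (@ring_isomorphic_chinese 3 5).
  - by right; left; apply: (@ring_isomorphic_chinese 3 7).
  - by do 3!right; left; apply: (@ring_isomorphic_chinese 5 7).
case=> [[_ [p [p_pr [_ iso]]]]|[_]].
  case: iso => f /(@bij_eq_card 'Z_n 'Z_(p ^ 2)); left; exists p => //.
  rewrite -(card_Zn n_gt1) -[RHS]card_Zn //.
  by rewrite (ltn_exp2l 0) ?prime_gt1.
case=> [/iso_card->//|]; first by right.
case=> [/iso_card->//|]; first by right.
case=> [/iso_card->//|]; first by left; exists 5%N.
case=> [/iso_card->//|]; first by right.
case=> [/iso_card->//|/iso_card->//]; first by left; exists 7%N.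
by left; exists 11%N.
Qed.
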